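(* Let $K=\mathbb{F}_q$ be a finite field, let $f_1,\ldots,f_s\in K[y_1,\ldots,y_n]$ and $g_1,\ldots,g_s\in K[y_1,\ldots,y_n]\setminus\{0\}$, and let $B=K[y_0,y_1,\ldots,y_n,z,t_1,\ldots,t_s]$ be a polynomial ring, with subring $S=K[t_1,\ldots,t_s]$. Let $\mathbb{X}\subset\mathbb{P}^{s-1}$ be the projective set parameterized by the rational functions $f_1/g_1,\ldots,f_s/g_s$. If $\mathbb{X}\neq\emptyset$, then $$I(\mathbb{X})=\left(\{g_it_i-f_iz\}_{i=1}^s,\ \{y_i^q-y_i\}_{i=1}^n,\ y_0g_1\cdots g_s-1\right)\cap S,$$ where the ideal on the right is taken in $B$.
   Context: $\mathbb{P}^{s-1}$ is the projective space over $K$, with points $[\alpha]$, $0\neq\alpha\in K^s$. The projective set parameterized by $f_1/g_1,\ldots,f_s/g_s$ is the set $\mathbb{X}$ of all points $[(f_1(x)/g_1(x),\ldots,f_s(x)/g_s(x))]\in\mathbb{P}^{s-1}$ with $x\in K^n$, $g_i(x)\neq 0$ for all $i$, and $f_i(x)\neq 0$ for some $i$. The ring $S=K[t_1,\ldots,t_s]$ has the standard grading, and $I(\mathbb{X})\subset S$, the vanishing ideal of $\mathbb{X}$, is the ideal generated by the homogeneous polynomials of $S$ that vanish at all points of $\mathbb{X}$. *)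

(* Defs.v *)
From mathcomp Require Import all_boot all_order all_algebra.
From mathcomp Require Import mpoly.

Set Implicit Arguments.
Unset Strict Implicit.
Unset Printing Implicit Defensive.

Import GRing.Theory.
Local Open Scope ring_scope.
Local Open Scope quotient_scope.

Definition ideal_generated_by (A : comNzRingType) (G : A -> Prop) (x : A) : Prop :=
  exists (m : nat) (c g : 'I_m -> A),
    (forall i, G (g i)) /\ x = \sum_(i < m) c i * g i.

Section ProjectiveSpace.
Variables (K : finFieldType) (s : nat).

Definition nonzero_vector := {a : 'rV[K]_s | a != 0}.

Definition proportional (a b : nonzero_vector) : bool :=
  [exists c : K, (c != 0) && (val b == c *: val a)].

Lemma proportional_refl : reflexive proportional.
Proof. by move=> a; apply/existsP; exists 1; rewrite oner_neq0 scale1r eqxx. Qed.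

Lemma proportional_imp (a b : nonzero_vector) :
  proportional a b -> proportional b a.
Proof.
case/existsP=> c /andP[c0 /eqP bE]; apply/existsP; exists c^-1.
by rewrite invr_eq0 c0 bE scalerA mulVf // scale1r eqxx.
Qed.

Lemma proportional_sym : ssrbool.symmetric proportional.
Proof. by move=> a b; apply/idP/idP; exact: proportional_imp. Qed.

Lemma proportional_trans : transitive proportional.
Proof.
move=> b a c /existsP[u /andP[u0 /eqP bE]] /existsP[v /andP[v0 /eqP cE]].
by apply/existsP; exists (v * u); rewrite mulf_neq0 //= cE bE scalerA.
Qed.

Canonical proportional_equiv :=
  EquivRel proportional proportional_refl proportional_sym proportional_trans.

(* The projective space of dimension s - 1, with s homogeneous coordinates. *)
Definition proj_space := {eq_quot proportional}.

Definition proj_point (a : 'rV[K]_s) (a_neq0 : a != 0) : proj_space :=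
  \pi_{eq_quot proportional} (exist _ a a_neq0).

(* P = [a]; in particular a is nonzero. *)
Definition is_point_of (P : proj_space) (a : 'rV[K]_s) : Prop :=
  exists a_neq0 : a != 0, P = proj_point a_neq0.

Definition vanishes_at (p : {mpoly K[s]}) (P : proj_space) : Prop :=
  forall a : 'rV[K]_s, is_point_of P a -> p.@[fun i => a 0 i] = 0.

Definition vanishing_ideal (X : proj_space -> Prop) : {mpoly K[s]} -> Prop :=
  ideal_generated_by (fun p : {mpoly K[s]} =>
    (exists d : nat, p \is d.-homog) /\ (forall P, X P -> vanishes_at p P)).

Definition parameterized_set (n : nat) (f g : 'I_s -> {mpoly K[n]})
    (P : proj_space) : Prop :=
  exists x : 'I_n -> K,
    [/\ forall i, (g i).@[x] != 0,
        exists i, (f i).@[x] != 0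
      & is_point_of P (\row_i ((f i).@[x] / (g i).@[x]))].

End ProjectiveSpace.

Section EliminationRing.
Variables (K : finFieldType) (n s : nat).

(* The variables of B are listed in the order y_0, y_1, ..., y_n, z,
   t_1, ..., t_s; yvar, tvar, f and g are indexed from 0, so that
   yvar i is y_(i+1) and tvar i is t_(i+1). *)
Definition B := {mpoly K[n.+1 + s.+1]}.

Definition y0var : B := 'X_(lshift s.+1 ord0).
Definition yvar (i : 'I_n) : B := 'X_(lshift s.+1 (lift ord0 i)).
Definition zvar : B := 'X_(rshift n.+1 ord0).
Definition tvar (i : 'I_s) : B := 'X_(rshift n.+1 (lift ord0 i)).

(* The inclusions of K[y_1, ..., y_n] and of S = K[t_1, ..., t_s] in B. *)
Definition y_incl (p : {mpoly K[n]}) : B := p \mPo [tuple yvar i | i < n].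
Definition t_incl (p : {mpoly K[s]}) : B := p \mPo [tuple tvar i | i < s].

Definition elimination_generators (f g : 'I_s -> {mpoly K[n]}) (b : B) : Prop :=
  [\/ exists i : 'I_s, b = y_incl (g i) * tvar i - y_incl (f i) * zvar,
      exists i : 'I_n, b = yvar i ^+ #|K| - yvar i
    | b = y0var * \prod_(i < s) y_incl (g i) - 1].

End EliminationRing.

(* Main.v *)
(** Write [F_i = f_i * prod_(j != i) g_j] and [G = prod_j g_j].  Modulo the
    elimination ideal [y_0] is an inverse of [G], so [t_i] is congruent to
    [y_0 z F_i] and a form [p] of degree [d] to [(y_0 z)^d p(F)].  If [p]
    vanishes on X, then [G p(F)] vanishes at every point of [K^n], hence lies in
    the ideal of the [y_i^q - y_i], and cancelling [G] puts [p] in the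
    elimination ideal.  Conversely, let [x] parameterize a point [[a]] of X.
    Sending [y] to [x], [y_0] to [1 / G(x)], [t_i] to [a_i 'X] and [z] to the
    indeterminate ['X] of [K['X]] kills all generators.  An element [p] of the
    elimination ideal thus satisfies [sum_d p_d(a) 'X^d = 0], and all its
    homogeneous components [p_d] vanish at [[a]]. *)

From HB Require Import structures.
Require Import Defs.
From mathcomp Require Import all_boot all_order all_algebra finfield.
From mathcomp Require Import mpoly ring.

Set Implicit Arguments.
Unset Strict Implicit.
Unset Printing Implicit Defensive.

Import GRing.Theory.
Local Open Scope ring_scope.

(** * Ideals as predicates, and congruences modulo an ideal *)

Definition is_ideal (A : comNzRingType) (I : A -> Prop) : Prop :=
  [/\ I 0, forall x y, I x -> I y -> I (x + y) & forall a x, I x -> I (a * x)].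

Section Ideals.
Variables (A : comNzRingType) (I : A -> Prop).
Hypothesis idI : is_ideal I.

Lemma is_ideal0 : I 0. Proof. by case: idI. Qed.
Lemma is_idealD x y : I x -> I y -> I (x + y). Proof. by case: idI => _ + _; apply. Qed.
Lemma is_idealMl a x : I x -> I (a * x). Proof. by case: idI => _ _; apply. Qed.
Lemma is_idealMr a x : I x -> I (x * a). Proof. by rewrite mulrC; apply: is_idealMl. Qed.
Lemma is_idealN x : I x -> I (- x). Proof. by rewrite -mulN1r; apply: is_idealMl. Qed.
Lemma is_idealB x y : I x -> I y -> I (x - y).
Proof. by move=> Ix /is_idealN; apply: is_idealD. Qed.

Lemma is_ideal_sum (J : Type) (r : seq J) (P : pred J) (F : J -> A) :
  (forall j, P j -> I (F j)) -> I (\sum_(j <- r | P j) F j).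
Proof. by move=> IF; apply: big_ind => //; [exact: is_ideal0 | exact: is_idealD]. Qed.

(** Modulo [I], [u] is an inverse of [v]. *)
Lemma is_ideal_cancel u v x : I (u * v - 1) -> I (v * x) -> I x.
Proof.
move=> Iuv Ivx; have -> : x = u * (v * x) - x * (u * v - 1) by ring.
by apply: is_idealB; exact: is_idealMl.
Qed.

(** Modulo [I], [b] has the inverse [u * a], so [b * t = c * z] can be solved for [t]. It will be
    used with [b], [c] the images of [g i], [f i], with [a] the product of the other denominators,
    and [u = y_0]. *)
Lemma is_ideal_solve a b c t u z :
  I (b * t - c * z) -> I (u * (b * a) - 1) -> I (t - u * z * (c * a)).
Proof.
move=> It Iu; have -> : t - u * z * (c * a) =
  u * a * (b * t - c * z) - t * (u * (b * a) - 1) by ring.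
by apply: is_idealB; exact: is_idealMl.
Qed.

Lemma is_ideal_congrM x x' y y' : I (x - x') -> I (y - y') -> I (x * y - x' * y').
Proof.
move=> Ix Iy; have -> : x * y - x' * y' = (x - x') * y + x' * (y - y') by ring.
by apply: is_idealD; [exact: is_idealMr | exact: is_idealMl].
Qed.

Lemma is_ideal_congrX x x' k : I (x - x') -> I (x ^+ k - x' ^+ k).
Proof.
move=> Ix; elim: k => [|k IHk]; first by rewrite subrr; exact: is_ideal0.
by rewrite !exprS; exact: is_ideal_congrM.
Qed.

Lemma is_ideal_congr_prod (J : Type) (r : seq J) (F F' : J -> A) :
  (forall j, I (F j - F' j)) -> I (\prod_(j <- r) F j - \prod_(j <- r) F' j).
Proof.
move=> IF; apply: (big_ind2 (fun x y => I (x - y))) => //.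
- by rewrite subrr; exact: is_ideal0.
- by move=> *; exact: is_ideal_congrM.
Qed.

Lemma is_ideal_congr_mmap (R : comNzRingType) (h : {rmorphism R -> A}) n
    (v w : 'I_n -> A) (p : {mpoly R[n]}) :
  (forall i, I (v i - w i)) -> I (mmap h v p - mmap h w p).
Proof.
move=> Ivw; rewrite /mmap -sumrB; apply: is_ideal_sum => m _.
rewrite -mulrBr; apply: is_idealMl; apply: is_ideal_congr_prod => i.
exact: is_ideal_congrX.
Qed.

(** This is the ideal quotient [(I : y)]. Congruences modulo it are congruences modulo [I] after
    multiplication by [y]. *)
Lemma is_ideal_colon y : is_ideal (fun x => I (x * y)).
Proof.
split=> [|a b|a b]; first by rewrite mul0r; exact: is_ideal0.
  by rewrite mulrDl; exact: is_idealD.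
by rewrite -mulrA; exact: is_idealMl.
Qed.

Lemma ideal_generated_by_sub (G : A -> Prop) :
  (forall x, G x -> I x) -> forall x, ideal_generated_by G x -> I x.
Proof.
move=> GI x [m [c [g [Gg ->]]]]; apply: is_ideal_sum => i _.
by apply: is_idealMl; exact: GI.
Qed.

End Ideals.

Lemma ideal_generated_byP (A : comNzRingType) (G : A -> Prop) :
  is_ideal (ideal_generated_by G).
Proof.
split=> [|x y|a x].
- by exists 0%N, (fun=> 0), (fun=> 0); split=> [[]//|]; rewrite big_ord0.
- move=> [m [c [g [Gg ->]]]] [m' [c' [g' [Gg' ->]]]].
  exists (m + m')%N, (fun i => match split i with inl j => c j | inr j => c' j end),
    (fun i => match split i with inl j => g j | inr j => g' j end).
  split=> [i|]; first by case: splitP.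
  rewrite big_split_ord /=; congr (_ + _); apply: eq_bigr => i _.
    by rewrite (unsplitK (inl i)).
  by rewrite (unsplitK (inr i)).
- move=> [m [c [g [Gg ->]]]]; exists m, (fun i => a * c i), g; split=> //.
  by rewrite mulr_sumr; apply: eq_bigr => i _; rewrite mulrA.
Qed.

Lemma ideal_generated_by_gen (A : comNzRingType) (G : A -> Prop) x :
  G x -> ideal_generated_by G x.
Proof.
move=> Gx; exists 1%N, (fun=> 1), (fun=> x); split=> //.
by rewrite big_ord1 mul1r.
Qed.

Lemma is_ideal_kernel (A A' : comNzRingType) (phi : {rmorphism A -> A'}) :
  is_ideal (fun x => phi x = 0).
Proof.
split=> [|x y px py|a x px]; first exact: rmorph0.
  by rewrite rmorphD px py addr0.
by rewrite rmorphM px mulr0.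
Qed.

(** * Polynomial evaluation: ring morphisms and homogeneity *)

Lemma rmorph_mmap (R A A' : comNzRingType) n (phi : {rmorphism A -> A'})
    (h : {rmorphism R -> A}) (h' : {rmorphism R -> A'}) (v : 'I_n -> A)
    (v' : 'I_n -> A') (p : {mpoly R[n]}) :
  (forall c, phi (h c) = h' c) -> (forall i, phi (v i) = v' i) ->
  phi (mmap h v p) = mmap h' v' p.
Proof.
move=> hE vE; rewrite /mmap rmorph_sum; apply: eq_bigr => m _.
rewrite rmorphM hE rmorph_prod; congr (_ * _); apply: eq_bigr => i _.
by rewrite rmorphXn vE.
Qed.

(** Each monomial of degree [d] contributes a factor [c ^+ d]. The ring element [c] will be a
    scalar, possibly 0, or [y_0 z], or the indeterminate ['X]. *)
Lemma mmap_dhomog (R A : comNzRingType) n (h : {rmorphism R -> A}) (c : A)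
    (v : 'I_n -> A) d (p : {mpoly R[n]}) :
  p \is d.-homog -> mmap h (fun i => c * v i) p = c ^+ d * mmap h v p.
Proof.
move=> /dhomogP hp; rewrite /mmap mulr_sumr; apply: eq_big_seq => m /hp mE.
rewrite mulrCA; congr (_ * _); rewrite /mmap1.
under eq_bigr do rewrite exprMn.
by rewrite big_split /= -expr_sum -mdegE mE.
Qed.

(** * Polynomials vanishing at all points over a finite field *)

Section FiniteField.
Variable K : finFieldType.

(** These are the Lagrange interpolation polynomials at all points of [K]. Their sum minus 1 has
    degree less than [#|K|] and vanishes on [K], so it is zero; multiplying [L c] by its missing
    linear factor gives a multiple of the product of all ['X - x%:P], which is ['X^#|K| - 'X]. *)
Lemma finField_lagrange : exists L : K -> {poly K},
  \sum_c L c = 1 /\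
  forall c, exists k : K, ('X - c%:P) * L c = k *: ('X^#|K| - 'X).
Proof.
pose w (c : K) := \prod_(x : K | x != c) (c - x).
pose L (c : K) : {poly K} := (w c)^-1 *: \prod_(x : K | x != c) ('X - x%:P).
have w_neq0 c : w c != 0.
  by apply/prodf_neq0 => x xc; rewrite subr_eq0 eq_sym.
have LE x c : (L c).[x] = (x == c)%:R.
  rewrite hornerZ horner_prod; under eq_bigr do rewrite hornerXsubC.
  have [->|xc] := eqVneq x c; first by rewrite mulVf.
  by rewrite (bigD1 x) //= subrr mul0r mulr0.
exists L; split; last first.
  move=> c; exists (w c)^-1; rewrite finField_genPoly (bigD1 c) //=.
  by rewrite -scalerAr.
apply/eqP; rewrite -subr_eq0; apply/eqP.
apply: (@roots_geq_poly_eq0 _ _ (enum K)).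
- apply/allP => x _; rewrite rootE hornerD hornerN hornerC horner_sum.
  under eq_bigr do rewrite LE.
  by rewrite (bigD1 x) //= big1 ?eqxx ?addr0 ?subrr // => c /negbTE; rewrite eq_sym => ->.
- exact: enum_uniq.
- have K_gt0 : (0 < #|K|)%N by rewrite ltnW // finNzRing_gt1.
  rewrite -cardE; apply: leq_trans (size_polyD _ _) _.
  rewrite geq_max size_polyN size_poly1 K_gt0 andbT.
  apply: leq_trans (size_sum _ _ _) _; apply/bigmax_leqP => c _.
  apply: leq_trans (size_scale_leq _ _) _.
  rewrite (eq_bigl (mem (predC1 c))) //.
  by rewrite -big_enum size_prod_XsubC -cardE cardC1 prednK.
Qed.

(* The interpolation idempotent [delta] of a point [x] satisfies
   [y_i * delta = x_i * delta] modulo the ideal, so [P(y)] is congruent to the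
   sum over [x] of the [P(x) * delta]. *)
Lemma ideal_vanishing_poly (A : comAlgType K) (I : A -> Prop) n (y : 'I_n -> A)
    (P : {mpoly K[n]}) :
  is_ideal I -> (forall i, I (y i ^+ #|K| - y i)) ->
  (forall x : 'I_n -> K, P.@[x] = 0) -> I (mmap (in_alg A) y P).
Proof.
move=> idI Iy P0; have [L [sumL LE]] := finField_lagrange.
(* Each sum of the [L c] evaluated at [y i] is 1; expanding the product over [i] gives one term for
   each point [x]. *)
have one : 1 = \sum_(x : {ffun 'I_n -> K}) \prod_i horner_alg (y i) (L (x i)).
  rewrite -(bigA_distr_bigA (fun i c => horner_alg (y i) (L c))) big1 // => i _.
  by rewrite -rmorph_sum sumL rmorph1.
rewrite -[mmap _ _ _]mulr1 one mulr_sumr; apply: is_ideal_sum => // x _.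
set delta := \prod_i _; have idD := is_ideal_colon idI delta.
(* Since [P] vanishes at [x], its value there may be subtracted, which leaves a congruence modulo
   the quotient of [I] by [delta]. *)
have -> : mmap (in_alg A) y P =
    mmap (in_alg A) y P - mmap (in_alg A) (fun i => in_alg A (x i)) P.
  rewrite -[X in _ - X](@rmorph_mmap _ _ _ _ (in_alg A) idfun _ x) //.
  by rewrite -[mmap idfun _ _]/(P.@[x]) P0 rmorph0 subr0.
apply: (is_ideal_congr_mmap idD) => i.
rewrite /delta (bigD1 i) //= mulrA; apply: is_idealMr => //.
have [k /(congr1 (horner_alg (y i)))] := LE (x i).
rewrite rmorphM rmorphB /= linearZ /= rmorphB rmorphXn /= horner_algX horner_algC => ->.
by rewrite -mulr_algl; apply: is_idealMl.
Qed.

End FiniteField.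

(** * Forms vanishing on the parameterized set lie in the elimination ideal *)

Section Elimination.
Variables (K : finFieldType) (n s : nat) (f g : 'I_s -> {mpoly K[n]}).

Local Notation J := (ideal_generated_by (elimination_generators f g)).

Let idJ : is_ideal J := ideal_generated_byP _.

Lemma y_inclE (q : {mpoly K[n]}) :
  y_incl s q = mmap (@mpolyC _ K) (@yvar K n s) q.
Proof.
apply: eq_bigr => m _; congr (_ * _).
by apply: mmap1_eq => i; rewrite tnth_mktuple.
Qed.

Lemma y_inclM p q : y_incl s (p * q) = y_incl s p * y_incl s q :> B K n s.
Proof. exact: (rmorphM (comp_mpoly _)). Qed.

Lemma t_inclE (p : {mpoly K[s]}) :
  t_incl n p = mmap (@mpolyC _ K) (@tvar K n s) p.
Proof.
apply: eq_bigr => m _; congr (_ * _).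
by apply: mmap1_eq => i; rewrite tnth_mktuple.
Qed.

Definition numerator (i : 'I_s) : {mpoly K[n]} := f i * \prod_(j | j != i) g j.

Lemma y_incl_vanishing (P : {mpoly K[n]}) :
  (forall x, P.@[x] = 0) -> J (y_incl s P).
Proof.
move=> P0; rewrite y_inclE.
have -> : mmap (@mpolyC _ K) (@yvar K n s) P =
    mmap (in_alg {mpoly K[n.+1 + s.+1]}) (@yvar K n s) P.
  by apply: eq_bigr => m _; rewrite /= mul_mpolyC mulr_algl.
apply: ideal_vanishing_poly => // i.
by apply: ideal_generated_by_gen; apply: Or32; exists i.
Qed.

Lemma denominators_inverse :
  J (y0var K n s * y_incl s (\prod_i g i) - 1).
Proof.
by apply: ideal_generated_by_gen; apply: Or33; rewrite /y_incl rmorph_prod.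
Qed.

Lemma tvar_congr i :
  J (tvar K n i - y0var K n s * zvar K n s * y_incl s (numerator i)).
Proof.
have Jg : J (y_incl s (g i) * tvar K n i - y_incl s (f i) * zvar K n s).
  by apply: ideal_generated_by_gen; apply: Or31; exists i.
have := denominators_inverse; rewrite (bigD1 i) //= /numerator !y_inclM.
exact: is_ideal_solve.
Qed.

Lemma vanishing_in_elimination (p : {mpoly K[s]}) d :
    (exists P : proj_space K s, parameterized_set f g P) -> p \is d.-homog ->
  (forall P, parameterized_set f g P -> vanishes_at p P) -> J (t_incl n p).
Proof.
move=> [P0 XP0] hp p0; pose Q := mmap (@mpolyC _ K) numerator p.
have QE x : Q.@[x] = p.@[fun i => (numerator i).@[x]].
  by apply: rmorph_mmap => // c; exact: mevalC.
(* This serves the points [x] where all [f i] vanish, which give no projective point. Scaling by 0 a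
   representative of a point of the nonempty set gives [p(0) = 0 ^+ d * p(a) = 0], also when [d] is
   0. *)
have p_origin : p.@[fun=> 0] = 0.
  have [x [_ _ xP]] := XP0; have pa := p0 _ XP0 _ xP.
  set a := fun i => _ in pa.
  have := mmap_dhomog idfun 0 a hp; rewrite -[mmap idfun a p]/(p.@[a]) pa mulr0 => E.
  by rewrite -[RHS]E; apply: meval_eq => i; rewrite mul0r.
have JGQ : J (y_incl s (\prod_i g i * Q)).
  apply: y_incl_vanishing => x; rewrite mevalM QE rmorph_prod /=.
  (* If a denominator vanishes at [x], so does the factor [\prod_i g i]. Otherwise [x] defines a
     vector [a], either zero or representing a point of the set. *)
  have [[i /eqP gi]|gx] : (exists i, (g i).@[x] == 0) \/ (forall i, (g i).@[x] != 0).
  - case: (altP (@forallP _ (fun i => (g i).@[x] != 0))) => [|/forallPn[i]]; first by right.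
    by rewrite negbK; left; exists i.
  - by rewrite (bigD1 i) //= gi !mul0r.
  pose a : 'rV[K]_s := \row_i ((f i).@[x] / (g i).@[x]).
  have pa : p.@[fun i => a 0 i] = 0.
    have [a0|a0] := eqVneq a 0.
      by rewrite -[RHS]p_origin; apply: meval_eq => i; rewrite a0 mxE.
    have isP : is_point_of (proj_point a0) a by exists a0.
    apply: p0 isP; exists x; split=> //; last by exists a0.
    have /rV0Pn[i] := a0; rewrite mxE mulf_eq0 negb_or => /andP[fi _].
    by exists i.
  pose G := \prod_i (g i).@[x].
  (* Clearing denominators: the numerators at [x] are the coordinates of [a] scaled by [G]. *)
  have -> : p.@[fun i => (numerator i).@[x]] = p.@[fun i => G * a 0 i].
    apply: meval_eq => i; rewrite mevalM rmorph_prod /= mxE /G [in RHS](bigD1 i) //=.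
    by rewrite [RHS]mulrC mulrA divfK.
  by rewrite [p.@[_]](mmap_dhomog idfun G _ hp) -[mmap idfun _ _]/(p.@[_]) pa !mulr0.
rewrite y_inclM in JGQ.
have JQ := is_ideal_cancel idJ denominators_inverse JGQ.
have := is_ideal_congr_mmap idJ (@mpolyC _ K) p tvar_congr.
rewrite -t_inclE (mmap_dhomog _ _ _ hp) => Jt.
have QE' : y_incl s Q = mmap (@mpolyC _ K) (fun i => y_incl s (numerator i)) p.
  by rewrite /y_incl; apply: rmorph_mmap => // c; exact: comp_mpolyC.
rewrite -QE' in Jt.
by rewrite -[t_incl n p](subrK ((y0var K n s * zvar K n s) ^+ d * y_incl s Q));
  apply: is_idealD => //; apply: is_idealMl.
Qed.

(** * Evaluation of the elimination ideal on the line through a representative of a point *)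

Section Evaluation.
Variables (x : 'I_n -> K) (gx : forall i, (g i).@[x] != 0).

Let a i := (f i).@[x] / (g i).@[x].

(** Index 0 of the two blocks of variables is [y_0], respectively [z]. Sending [z] to ['X] rather
    than to 1 makes the powers of ['X] separate the homogeneous components. *)
Definition curve_coord (k : 'I_(n.+1 + s.+1)) : {poly K} :=
  match split k with
  | inl i => if unlift ord0 i is Some j then (x j)%:P else ((\prod_i (g i).@[x])^-1)%:P
  | inr i => if unlift ord0 i is Some j then 'X * (a j)%:P else 'X
  end.

Definition curve_eval : B K n s -> {poly K} := mmap polyC curve_coord.

HB.instance Definition _ := GRing.RMorphism.copy curve_eval (mmap polyC curve_coord).

Lemma curve_evalXU k : curve_eval 'X_k = curve_coord k.
Proof. by rewrite /curve_eval mmapX mmap1U. Qed.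

Lemma curve_eval_y0 : curve_eval (y0var K n s) = ((\prod_i (g i).@[x])^-1)%:P.
Proof. by rewrite curve_evalXU /curve_coord (unsplitK (inl _)) unlift_none. Qed.

Lemma curve_eval_y i : curve_eval (yvar K s i) = (x i)%:P.
Proof. by rewrite curve_evalXU /curve_coord (unsplitK (inl _)) liftK. Qed.

Lemma curve_eval_z : curve_eval (zvar K n s) = 'X.
Proof. by rewrite curve_evalXU /curve_coord (unsplitK (inr _)) unlift_none. Qed.

Lemma curve_eval_t i : curve_eval (tvar K n i) = 'X * (a i)%:P.
Proof. by rewrite curve_evalXU /curve_coord (unsplitK (inr _)) liftK. Qed.

Lemma curve_evalC c : curve_eval c%:MP = c%:P.
Proof. by rewrite /curve_eval mmapC. Qed.

Lemma polyC_meval m (v : 'I_m -> K) (q : {mpoly K[m]}) :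
  (q.@[v])%:P = mmap (@polyC K) (fun i => (v i)%:P) q.
Proof. exact: (rmorph_mmap (phi := @polyC K)). Qed.

Lemma curve_eval_y_incl q : curve_eval (y_incl s q) = (q.@[x])%:P.
Proof.
rewrite y_inclE polyC_meval; apply: rmorph_mmap; [exact: curve_evalC|].
exact: curve_eval_y.
Qed.

Lemma curve_eval_t_incl p :
  curve_eval (t_incl n p) = mmap (@polyC K) (fun i => 'X * (a i)%:P) p.
Proof.
rewrite t_inclE; apply: rmorph_mmap; [exact: curve_evalC | exact: curve_eval_t].
Qed.

(** The three kinds of generators vanish because [g_i(x) * a i = f_i(x)], because elements of [K]
    are fixed by the power [#|K|], and because [y_0] is sent to the inverse of the product of the
    [g_i(x)]. *)
Lemma curve_eval_elimination b : J b -> curve_eval b = 0.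
Proof.
apply: (ideal_generated_by_sub (is_ideal_kernel curve_eval)) => {}b.
case=> [[i ->]|[i ->]|->].
- rewrite rmorphB !rmorphM /= !curve_eval_y_incl curve_eval_t curve_eval_z.
  by rewrite mulrCA -rmorphM /= /a mulrCA divff ?gx // mulr1 mulrC subrr.
- by rewrite rmorphB rmorphXn /= curve_eval_y -rmorphXn /= expf_card subrr.
- rewrite rmorphB rmorphM rmorph_prod rmorph1 /=.
  under eq_bigr do rewrite curve_eval_y_incl.
  rewrite curve_eval_y0 -(rmorph_prod (@polyC K)) -polyCM mulVf ?subrr //.
  by apply/prodf_neq0.
Qed.

Lemma elimination_pihomog_eval p d : J (t_incl n p) -> (pihomog mdeg d p).@[a] = 0.
Proof.
move=> /curve_eval_elimination; rewrite curve_eval_t_incl.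
(* The enlarged bound makes [d] an index of the decomposition even when [d] is at least
   [msize p]. *)
have ltd : (d < maxn d.+1 (msize p))%N by rewrite leq_max ltnSn.
rewrite {1}(@pihomog_partitionE _ _ mdeg _ _ (leq_maxr d.+1 (msize p))).
rewrite rmorph_sum /= => /(congr1 (fun q : {poly K} => q`_d)).
(* The component of degree [e] contributes its value at [a] times ['X^e], so only [e = d] survives
   in the coefficient of degree [d]. *)
rewrite coef_sum coef0 (bigD1 (Ordinal ltd)) //= big1 => [|e ed].
  rewrite (mmap_dhomog _ _ _ (pihomogP mdeg d p)) -polyC_meval.
  by rewrite coefMC coefXn eqxx mul1r addr0.
rewrite (mmap_dhomog _ _ _ (pihomogP mdeg e p)) -polyC_meval.
by rewrite coefMC coefXn eq_sym -[_ == _]/(e == Ordinal ltd) (negbTE ed) mul0r.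
Qed.

End Evaluation.

End Elimination.

(** * Independence of representatives, and the two inclusions *)

Lemma vanishes_at_dhomog (K : finFieldType) s (p : {mpoly K[s]}) d
    (P : proj_space K s) (a : 'rV[K]_s) :
  p \is d.-homog -> is_point_of P a -> p.@[fun i => a 0 i] = 0 -> vanishes_at p P.
Proof.
move=> hp [a0 ->] pa b [b0] /eqP; rewrite eqmodE => /existsP[c /andP[_ /eqP /= bE]].
(* Any other representative is [c *: a], where the form takes [c ^+ d] times its value at [a]. *)
rewrite bE (@meval_eq _ _ _ (fun i => c * a 0 i)) => [|i]; last by rewrite mxE.
by rewrite [LHS](mmap_dhomog idfun c _ hp) [mmap _ _ _]pa mulr0.
Qed.

Theorem theorem3p8 (K : finFieldType) (n s : nat)
    (f g : 'I_s -> {mpoly K[n]}) (g_neq0 : forall i, g i != 0)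
    (X_neq0 : exists P : proj_space K s, parameterized_set f g P) :
  forall p : {mpoly K[s]},
    vanishing_ideal (parameterized_set f g) p <->
    ideal_generated_by (elimination_generators f g) (t_incl n p).
Proof.
move=> p; split.
  have idJ := ideal_generated_byP (elimination_generators f g).
  case=> m [c [q [qX ->]]]; rewrite /t_incl rmorph_sum.
  apply: is_ideal_sum => // i _; rewrite rmorphM; apply: is_idealMl => //.
  by have [[d hd] q0] := qX i; exact: vanishing_in_elimination hd q0.
(* It suffices that each homogeneous component of [p] vanishes on the set, since it is then a
   generator of the vanishing ideal. *)
move=> Jp; rewrite (pihomog_partitionE (leqnn (msize p))).
have idX := ideal_generated_byP
  (fun q : {mpoly K[s]} => (exists d, q \is d.-homog) /\
     (forall P, parameterized_set f g P -> vanishes_at q P)).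
apply: (is_ideal_sum idX) => d _; apply: ideal_generated_by_gen; split.
  by exists d; exact: pihomogP.
move=> P [x [gx _ xP]]; apply: vanishes_at_dhomog (pihomogP _ _ _) xP _.
rewrite -[RHS](elimination_pihomog_eval gx d Jp).
by apply: meval_eq => i; rewrite mxE.
Qed.
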